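(* Let $(a_n)_{n\geq 0}$ be a sequence of positive integers satisfying the recurrence \[ a_n=\sum_{i=1}^k b_i a_{n-i}\qquad\text{for all } n\geq k, \] for some positive integer $k$ and nonnegative integers $b_1,b_2,\ldots,b_k$ with $b_1+b_2+\cdots+b_k\geq 2$. Then there exist a meta-Fibonacci sequence $(q_n)_{n\geq 0}$ and a positive integer $s$ such that $q_{sn}=a_n$ for all $n\geq 0$.
   Context: A meta-Fibonacci sequence is a sequence of integers $(q_n)_{n\geq n_0}$ (here $n_0=0$) that eventually satisfies a recurrence of the form \[ M(n)=\sum_{i=1}^{K} c_i\, M\bigl(n-M(n-i)\bigr) \] for some fixed positive integers $K$ and $c_1,\ldots,c_K$; that is, there is an $N$ such that for all $n\geq N$, $q_n=\sum_{i=1}^{K} c_i\, q_{n-q_{n-i}}$. Throughout, the convention is used that $q_m=0$ whenever $m<n_0$ (so terms evaluated at indices below the starting index count as $0$). *)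

(* Defs.v *)
From mathcomp Require Import all_boot all_order all_algebra.

Set Implicit Arguments.
Unset Strict Implicit.
Unset Printing Implicit Defensive.

Import Order.TTheory GRing.Theory Num.Theory.
Local Open Scope ring_scope.

(* A sequence starting at index 0, read at an arbitrary integer index, with
   the convention that terms before the starting index are 0. *)
Definition ext0 (q : nat -> int) (m : int) : int :=
  if m is Posz n then q n else 0.

(* M(n) = \sum_(1 <= i <= K) c_i M(n - M(n - i)) for all n >= N.  Being a
   recurrence, it must express q_n through terms of smaller index, hence the
   first conjunct: without it a value q_(n-i) = 0 would make q_n occur in its
   own definition (so that K = c_1 = 1 would already be tautologically
   satisfied at n whenever q_(n-1) = 0), and a negative one would refer to
   later terms. *)
Definition nested_rec_from (K : nat) (c : nat -> nat) (N : nat)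
    (q : nat -> int) : Prop :=
  forall n : nat, (N <= n)%N ->
    (forall i : nat, (1 <= i <= K)%N ->
       n%:Z - ext0 q (n%:Z - i%:Z) < n%:Z) /\
    q n = \sum_(1 <= i < K.+1)
            (c i)%:Z * ext0 q (n%:Z - ext0 q (n%:Z - i%:Z)).

Definition meta_Fibonacci (q : nat -> int) : Prop :=
  exists (K : nat) (c : nat -> nat) (N : nat),
    [/\ (0 < K)%N,
        forall i : nat, (1 <= i <= K)%N -> (0 < c i)%N
      & nested_rec_from K c N q].

(* Main.v *)
Require Import Defs.
From mathcomp Require Import all_boot all_order all_algebra.
From mathcomp Require Import zify.

Set Implicit Arguments.
Unset Strict Implicit.
Unset Printing Implicit Defensive.

Import Order.TTheory GRing.Theory Num.Theory.
Local Open Scope ring_scope.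

(* Take every c_i = 1, write the sum of the b_i as h + 1 with h >= 1, and list
   each j with multiplicity b_j as J 0, ..., J h.  With K = 2h and s = 4h + 2,
   q is an interleaving of s sequences.  On the residue class of 0 it is a.  At
   the other positions q is either a constant, or a linear term, or larger than
   the index by more than K.  In the sum giving q_n, a large term contributes 0
   since it points before the start; a constant s j contributes q_(n - s j), in
   the class of n; the linear term equals s floor(n / s) and contributes q_r
   with r = n mod s, a value of period 0 which is free to choose and serves to
   correct the constant classes.  The K terms before a multiple of s are h + 1
   constants s J_t and h - 1 large ones, so q_(s m) = \sum_t a_(m - J_t). *)

(** * Solving a nested recurrence from prescribed initial values *)

Lemma nested_rec_existence (K N : nat) (init : nat -> int) :
  exists q : nat -> int,
    (forall n, (n < N)%N -> q n = init n) /\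
    (forall n, (N <= n)%N ->
       (forall i, (1 <= i <= K)%N -> n%:Z - ext0 q (n%:Z - i%:Z) < n%:Z) ->
       q n = \sum_(1 <= i < K.+1) ext0 q (n%:Z - ext0 q (n%:Z - i%:Z))).
Proof.
(* Course-of-values recursion: [w n] lists the first n values. The default of [nth] would be read
   only at an index outside this prefix, which the premise on back references excludes. *)
pose next n (w : seq int) := if (n < N)%N then init n else
  \sum_(1 <= i < K.+1)
     ext0 (nth 0 w) (n%:Z - ext0 (nth 0 w) (n%:Z - i%:Z)).
pose fix w n := if n is n'.+1 then rcons (w n') (next n' (w n')) else [::].
pose q n := next n (w n).
have wE n : w n = mkseq q n.
  by elim: n => [//|n IHn] /=; rewrite mkseqS -IHn.
have w_ext n (z : int) : z < n%:Z -> ext0 (nth 0 (w n)) z = ext0 q z.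
  by case: z => [j|//] /= ltjn; rewrite wE nth_mkseq.
exists q; split=> [n ltnN|n leNn back]; first by rewrite /q /next ltnN.
rewrite {1}/q /next ltnNge leNn /=.
apply: eq_big_nat => i /andP[i_gt0 leiK].
rewrite [ext0 (nth 0 (w n)) (n%:Z - i%:Z)]w_ext ?w_ext //; last by lia.
by apply: back; rewrite i_gt0.
Qed.

Lemma ler_sum_two (F : nat -> int) (m n i j : nat) :
  (forall l, (m <= l < n)%N -> 0 <= F l) ->
  (m <= i < n)%N -> (m <= j < n)%N -> i != j ->
  F i + F j <= \sum_(m <= l < n) F l.
Proof.
move=> F_ge0 i_in j_in neq_ij.
rewrite (bigD1_seq i) ?iota_uniq ?mem_index_iota //= lerD2l.
rewrite big_mkcond (bigD1_seq j) ?iota_uniq ?mem_index_iota //=.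
rewrite eq_sym neq_ij lerDl big_mkcond big_nat; apply: sumr_ge0 => l l_in.
by do ?[case: ifP => // _]; exact: F_ge0.
Qed.

(** Matches the alternation of constant and large classes just before a multiple of s. *)
Lemma sum_odd_even (F : nat -> int) (h : nat) :
  \sum_(1 <= i < (2 * h).+1) F i =
  \sum_(1 <= u < h.+1) (F (2 * u).-1 + F (2 * u)%N).
Proof.
elim: h => [|h IHh]; first by rewrite muln0 !big_geq.
rewrite [RHS]big_nat_recr // -IHh mulnS add2n 2?big_nat_recr //=.
by rewrite addrA.
Qed.

Lemma expand_multiplicities (b : nat -> nat) (k : nat) :
  exists w : seq nat,
    [/\ size w = (\sum_(1 <= i < k.+1) b i)%N,
        all (fun j => 0 < j <= k)%N w
      & forall F : nat -> nat,
          (\sum_(j <- w) F j = \sum_(1 <= i < k.+1) b i * F i)%N].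
Proof.
have sumE (F : nat -> nat) :
  (\sum_(j <- flatten [seq nseq (b i) i | i <- index_iota 1 k.+1]) F j
     = \sum_(1 <= i < k.+1) b i * F i)%N.
  rewrite big_flatten big_map; apply: eq_bigr => i _.
  by rewrite big_nseq iter_addn_0 mulnC.
exists (flatten [seq nseq (b i) i | i <- index_iota 1 k.+1]); split => //.
  by rewrite -sum1_size sumE; apply: eq_bigr => i _; rewrite muln1.
apply/allP => j /flatten_mapP[i]; rewrite mem_index_iota => i_in.
by rewrite mem_nseq => /andP[_ /eqP->].
Qed.

Lemma expn2_dominates (c x : nat) : (2 * c <= x)%N -> (c * x.+1 < 2 ^ x)%N.
Proof.
move=> /subnK <-; elim: (x - 2 * c)%N => [|y IHy].
  rewrite add0n; elim: c => [//|c IHc].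
  rewrite [(2 * c.+1)%N]mulnS add2n !expnS; nia.
rewrite !addSn expnS; nia.
Qed.

(** * Exponential growth of the linear recurrence *)

Section Growth.

Variables (a : nat -> nat) (k : nat) (b : nat -> nat).
Hypotheses (a_gt0 : forall n : nat, (0 < a n)%N) (k_gt0 : (0 < k)%N)
  (b_ge2 : (2 <= \sum_(1 <= i < k.+1) b i)%N)
  (a_rec : forall n : nat, (k <= n)%N ->
     a n = (\sum_(1 <= i < k.+1) b i * a (n - i))%N).

(** Going back at most k indices lowers the exponent by at most one, and the weights, of sum at
    least 2, make up for it. *)
Lemma linear_rec_ge_expn n : (2 ^ (n %/ k) <= a n)%N.
Proof.
elim/ltn_ind: n => n IHn.
case: (ltnP n k) => [ltnk|lekn]; first by rewrite divn_small.
rewrite a_rec // -(subnK lekn) divnDr // divnn k_gt0 addn1 expnS.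
apply: leq_trans (leq_mul b_ge2 (leqnn _)) _.
rewrite big_distrl /= !big_nat; apply: leq_sum => i i_in.
rewrite leq_mul2l; apply/orP; right.
apply: leq_trans (IHn _ _); last by lia.
by rewrite leq_exp2l // leq_div2r //; lia.
Qed.

Lemma linear_rec_dominates (c d : nat) :
  exists M, forall m, (M <= m)%N -> (c * m + d < a m)%N.
Proof.
(* With x = m %/ k one has m < k (x + 1), hence c m + d <= (c k + d) (x + 1) < 2 ^ x once x >= 2 (c
   k + d). *)
exists (k * (2 * (c * k + d)))%N => m leMm.
apply: leq_trans (linear_rec_ge_expn m).
have /expn2_dominates : (2 * (c * k + d) <= m %/ k)%N.
  by rewrite leq_divRL // mulnC.
have := ltn_ceil m k_gt0; rewrite mulSn.
set x := (m %/ k)%N => ltm; nia.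
Qed.

End Growth.

(** * The interleaved sequence and its residue classes *)

Section Construction.

Variables (a : nat -> nat) (k h s M : nat) (J : nat -> nat).
Hypotheses (h_gt0 : (0 < h)%N) (s_def : s = (4 * h + 2)%N).
Hypothesis J_in : forall t, (t <= h)%N -> (0 < J t <= k)%N.
Hypothesis a_rec : forall m, (k <= m)%N ->
  a m = (\sum_(0 <= t < h.+1) a (m - J t))%N.
Hypothesis a_large : forall m, (M <= m)%N -> (s * m + 2 * h < a m)%N.

(* Residue classes modulo s, with the value of q at s m + r for m > 0:
     0                         a_m
     2h - 1                    s
     2h                        2
     2h + 1                    s m
     2h + 2 + 2t  (t < h)      s J_t
     4h + 1                    s J_h
     all others                large [grow].
   Class 2h - 1 sees only class 4h + 1, its left neighbours being large; class
   2h sees only the s of class 2h - 1; class 2h + 1 sees the 2, which points to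
   an s, and the s, which points to its own previous term: slope 1. *)
Definition grow (r : nat) : bool :=
  ((1 <= r <= 2 * h - 2) || ((2 * h + 3 <= r <= 4 * h - 1) && odd r))%N.

Definition const (r : nat) : bool :=
  [&& r != 0, r != 2 * h + 1 & ~~ grow r]%N.

Definition cval (r : nat) : nat :=
  if r == (2 * h - 1)%N then s else if r == (2 * h)%N then 2%N
  else (s * J (if r == 4 * h + 1 then h else (r - (2 * h + 2))./2))%N.

(* The value of q at r < s which makes the recurrence at s m + r yield
   [cval r]: it is [cval r] minus the contributions of the visible constants.
   Seen from r, the constant 2 in class 2h points to class r - 2, and every
   other constant points to class r. *)
Definition shift (r : nat) : int :=
  (cval r)%:Z - \sum_(1 <= i < (2 * h).+1)
    (if const (r - i) then
       if (r - i == 2 * h)%N then (cval (r - 2))%:Z else (cval r)%:Z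
     else 0).

Definition shape (m r : nat) : int :=
  if r == 0%N then (a m)%:Z
  else if m == 0%N then
    if (2 * h + 2 <= r)%N && ~~ grow r then shift r else 0
  else if r == (2 * h + 1)%N then (s * m)%:Z else (cval r)%:Z.

(** Large classes are only bounded below; the margin 2h keeps such a value beyond each of the next
    2h positions. In block 0 they hold 0. *)
Definition good (q : nat -> int) (m r : nat) : Prop :=
  let x := q (s * m + r)%N in
  if grow r && (0 < m)%N then ((s * m + r + 2 * h)%:Z < x : Prop) else x = shape m r.

Lemma cval_mul r : (r < s)%N -> const r -> r != (2 * h)%N ->
  exists2 j, (0 < j <= k)%N & cval r = (s * j)%N.
Proof.
rewrite /const /grow /cval => ltrs rC /negPf->.
case: eqP => [_|r_neq]; first by exists 1%N; [have := J_in (leq0n h); lia|lia].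
by eexists; [|reflexivity]; apply: J_in; case: eqP => // ?; lia.
Qed.

(** Serves where the constant 2 redirects to class r - 2. In this range the constant classes are the
    even ones, and 2h is constant too. *)
Lemma const_sub2 r : (2 * h + 2 <= r <= 4 * h)%N -> const r ->
  const (r - 2).
Proof. rewrite /const /grow; lia. Qed.

(** * The 2h positions before n and the terms they produce *)

Section Step.

Variables (q : nat -> int) (m r : nat).
Hypotheses (le_m : (M + 2 * k + 2 <= m)%N) (ltrs : (r < s)%N).
Hypothesis IH : forall m' r', (r' < s)%N ->
  (s * m' + r' < s * m + r)%N -> good q m' r'.

Let n := (s * m + r)%N.
Let W i := ext0 q (n%:Z - i%:Z).
Let T i := ext0 q (n%:Z - W i).
Let res i := if (i <= r)%N then (r - i)%N else (r + s - i)%N.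

Let k_gt0 : (0 < k)%N. Proof. by have := J_in (leq0n h); lia. Qed.

Let res_lt i : (1 <= i <= 2 * h)%N -> (res i < s)%N.
Proof. rewrite /res; case: ifP; lia. Qed.

Lemma window i : (1 <= i <= 2 * h)%N ->
  exists m', [/\ (M <= m')%N, (0 < m')%N,
    (s * m' + res i + i)%N = n, W i = q (s * m' + res i)%N &
    good q m' (res i) /\ m' = if (i <= r)%N then m else m.-1].
Proof.
move=> i_in; have lt_res := res_lt i_in.
exists (if (i <= r)%N then m else m.-1).
have posE : (s * (if (i <= r)%N then m else m.-1) + res i + i)%N = n.
  rewrite /res /n; case: ifP => leir; first lia.
  have -> : m = m.-1.+1 by lia.
  rewrite mulnS /=; lia.
split=> //; try by case: ifP => _; lia.
  rewrite /W -posE; set x := (s * _ + _)%N.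
  by rewrite PoszD addrK.
split=> //; apply: IH => //; rewrite -/n; lia.
Qed.

(** The margin 2h in [good] and in [a_large] absorbs the distance i; thus class 0 also acts as a
    large class when seen from later positions. *)
Lemma W_far i : (1 <= i <= 2 * h)%N -> grow (res i) || (res i == 0)%N ->
  n%:Z < W i.
Proof.
move=> i_in res_i; have [m' [leMm' m'_gt0 posE -> [good_i _]]] := window i_in.
move: good_i; rewrite /good; case: ifP => [_|]; first lia.
rewrite m'_gt0 andbT => grow_i; move: res_i; rewrite grow_i /= => /eqP res0.
rewrite /shape res0 eqxx => ->; have := a_large leMm'; lia.
Qed.

Lemma T_far i : (1 <= i <= 2 * h)%N -> grow (res i) || (res i == 0)%N ->
  T i = 0.
Proof.
move=> i_in /(W_far i_in); rewrite /T.
case E: (n%:Z - W i) => [x|x] //; lia.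
Qed.

Lemma W_lin i : (1 <= i <= 2 * h)%N -> res i = (2 * h + 1)%N ->
  W i = (s * m)%:Z.
Proof.
move=> i_in res_i; have [m' [_ m'_gt0 _ -> [good_i m'E]]] := window i_in.
move: good_i; rewrite /good /shape res_i.
have -> : grow (2 * h + 1) = false by rewrite /grow; lia.
rewrite /= addn1 /= eqxx (negPf (lt0n_neq0 m'_gt0)) => ->.
(* Wrapping into the previous block would give a residue of at least 2h + 2. *)
by move: res_i; rewrite m'E /res; case: ifP => //; lia.
Qed.

Lemma W_const i : (1 <= i <= 2 * h)%N -> const (res i) ->
  W i = (cval (res i))%:Z.
Proof.
move=> i_in /and3P[r0 rl rg]; have [m' [_ m'_gt0 _ -> [good_i _]]] := window i_in.
move: good_i; rewrite /good /shape (negPf r0) (negPf rl) (negPf rg) /=.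
by rewrite (negPf (lt0n_neq0 m'_gt0)).
Qed.

(** Positivity makes every reference of the recurrence point strictly backwards. *)
Lemma W_gt0 i : (1 <= i <= 2 * h)%N -> 0 < W i.
Proof.
move=> i_in; case res_i: (grow (res i) || (res i == 0)%N).
  by have := W_far i_in res_i; lia.
case: (eqVneq (res i) (2 * h + 1)%N) => [/(W_lin i_in)->|lin_i].
  by rewrite ltz_nat muln_gt0; lia.
have res_c : const (res i) by rewrite /const; lia.
rewrite W_const //; case: (eqVneq (res i) (2 * h)%N) => [->|nres].
  by rewrite /cval eqxx; case: ifP; lia.
have [j j_in ->] := cval_mul (res_lt i_in) res_c nres.
by rewrite ltz_nat muln_gt0; lia.
Qed.

Lemma T_lin i : (1 <= i <= 2 * h)%N -> res i = (2 * h + 1)%N -> T i = q r.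
Proof.
by move=> i_in res_i; rewrite /T (W_lin i_in res_i) /n PoszD addrC addKr.
Qed.

Lemma T_two i : (1 <= i <= 2 * h)%N -> res i = (2 * h)%N ->
  T i = q (s * m + (r - 2))%N.
Proof.
move=> i_in res_i; have res_c : const (res i) by rewrite res_i /const /grow; lia.
have r_gt1 : (1 < r)%N by move: res_i; rewrite /res; case: ifP; lia.
rewrite /T W_const // res_i /cval eqxx.
have -> : (2 * h == 2 * h - 1)%N = false by lia.
have -> : n%:Z - 2%:Z = (s * m + (r - 2))%N by rewrite /n; lia.
by [].
Qed.

Lemma T_own i j : (j <= k)%N -> W i = (s * j)%:Z ->
  T i = q (s * (m - j) + r)%N.
Proof.
move=> le_jk Wi; rewrite /T Wi.
have le_sj : (s * j <= s * m)%N by rewrite leq_mul2l; lia.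
have -> : n%:Z - (s * j)%:Z = (s * (m - j) + r)%N by rewrite mulnBr /n; lia.
by [].
Qed.

Lemma good_own j : (0 < j <= k)%N -> good q (m - j) r.
Proof.
move=> j_in; apply: IH => //; rewrite ltn_add2r ltn_mul2l; lia.
Qed.

Lemma T_const i : (1 <= i <= 2 * h)%N -> const (res i) ->
  res i != (2 * h)%N -> exists2 j, (0 < j <= k)%N &
    cval (res i) = (s * j)%N /\ T i = q (s * (m - j) + r)%N.
Proof.
move=> i_in res_c res_n.
have [j j_in vE] := cval_mul (res_lt i_in) res_c res_n.
exists j => //; split => //; apply: T_own; first lia.
by rewrite W_const // vE.
Qed.

Lemma T_const_const i : const r -> (1 <= i <= 2 * h)%N -> const (res i) ->
  res i != (2 * h)%N -> T i = (cval r)%:Z.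
Proof.
move=> /and3P[r0 rl rg] i_in res_c res_n.
have [j j_in [_ ->]] := T_const i_in res_c res_n.
have := good_own j_in; rewrite /good /shape.
rewrite (negPf r0) (negPf rl) (negPf rg) /=.
by have -> : (m - j == 0)%N = false by lia.
Qed.

(* Two terms of this kind add up to more than n + 2h. *)
Lemma T_recurs_gt i : (1 <= i <= 2 * h)%N -> grow r -> const (res i) ->
  res i != (2 * h)%N -> n%:Z + (2 * h)%:Z - (s * k)%:Z < T i.
Proof.
move=> i_in rg res_c res_n; have [j j_in [_ ->]] := T_const i_in res_c res_n.
have := good_own j_in; rewrite /good rg /=.
have -> : (0 < m - j)%N by lia.
have le_sj : (s * j <= s * k)%N by rewrite leq_mul2l; lia.
have le_sk : (s * k <= s * m)%N by rewrite leq_mul2l; lia.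
rewrite mulnBr /n; lia.
Qed.

Lemma le_sk_sm : (2 * (s * k) <= s * m)%N.
Proof. by rewrite mulnCA leq_mul2l; lia. Qed.

Lemma good_start : good q 0 r.
Proof. by apply: IH => //; rewrite ltn_add2r ltn_mul2l; lia. Qed.

(** Ensures that nothing cancels the two big terms of a large class: [shift] may be negative, but a
    large class starts with 0, so the linear term contributes 0. *)
Lemma T_ge0 i : (1 <= i <= 2 * h)%N -> grow r -> 0 <= T i.
Proof.
move=> i_in rg; case res_i: (grow (res i) || (res i == 0)%N).
  by rewrite T_far.
case: (eqVneq (res i) (2 * h + 1)%N) => [lin_i|lin_i].
  rewrite (T_lin i_in lin_i); move: good_start.
  rewrite /good muln0 add0n andbF /shape eqxx rg andbF => ->.
  by case: ifP.
have res_c : const (res i) by rewrite /const; lia.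
case: (eqVneq (res i) (2 * h)%N) => [two_i|nres]; last first.
  by have := T_recurs_gt i_in rg res_c nres; have := le_sk_sm; rewrite /n; lia.
have r_gt : (2 < r)%N.
  by move: two_i rg; rewrite /res /grow; case: ifP; lia.
rewrite (T_two i_in two_i).
have : good q m (r - 2) by apply: IH; lia.
rewrite /good /shape; have -> : (m == 0)%N = false by lia.
by case: ifP => _; [lia|case: ifP => _ ->; [|case: ifP]].
Qed.

(** * The recurrence on each kind of residue class *)

Hypothesis q_n : q n = \sum_(1 <= i < (2 * h).+1) T i.

Lemma step_main : r = 0%N -> good q m r.
Proof.
move=> r0; have rg : grow r = false by rewrite /grow; lia.
have rz : (r == 0)%N by rewrite r0.
rewrite /good /shape rg rz /= -/n q_n.
have T_a i t : (1 <= i <= 2 * h)%N -> (t <= h)%N ->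
    const (res i) -> cval (res i) = (s * J t)%N -> T i = (a (m - J t))%:Z.
  move=> i_in le_th res_c vE; have J_t := J_in le_th.
  rewrite (@T_own i (J t)) ?W_const ?vE //; last lia.
  by have := good_own J_t; rewrite /good /shape rg rz.
have T_even t : (t < h)%N -> T (2 * (h - t))%N = (a (m - J t))%:Z.
  move=> lt_th; have resE : res (2 * (h - t)) = (2 * h + 2 + 2 * t)%N.
    rewrite /res; case: ifP; lia.
  apply: T_a; rewrite ?resE; [lia|lia|rewrite /const /grow; lia|].
  rewrite /cval; do 3 (case: eqP => [|_]; first lia).
  by congr (s * J _)%N; lia.
have T_odd u : (1 < u < h.+1)%N -> T (2 * u).-1 = 0.
  move=> u_in; apply: T_far; first lia.
  by rewrite /res; case: ifP; rewrite /grow; lia.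
have T_1 : T 1%N = (a (m - J h))%:Z.
  have resE : res 1 = (4 * h + 1)%N by rewrite /res; case: ifP; lia.
  apply: T_a; rewrite ?resE; [lia|lia|rewrite /const /grow; lia|].
  by rewrite /cval eqxx; do 2 (case: eqP => [|_]; first lia).
rewrite sum_odd_even big_split /= big_ltn //= big_nat big1 ?addr0 //.
(* Offset 2u carries J_(h - u), so the even half is read backwards. *)
rewrite big_nat_rev big_add1 /= muln1 T_1 (@a_rec m); last lia.
rewrite big_nat_recr //= PoszD addrC; congr (_ + _).
rewrite (big_morph Posz PoszD (erefl _)); apply: eq_big_nat => t t_in.
by rewrite -T_even; [congr (T _); lia|lia].
Qed.

Lemma step_unit : r = (2 * h - 1)%N -> good q m r.
Proof.
move=> rE; have rc : const r by rewrite rE /const /grow; lia.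
have vE : cval r = s by rewrite /cval rE eqxx.
case/and3P: (rc) => r0 rl rg; rewrite /good /shape.
rewrite (negPf r0) (negPf rl) (negPf rg) /= -/n q_n.
have -> : (m == 0)%N = false by lia.
have resE : res (2 * h) = (4 * h + 1)%N by rewrite /res; case: ifP; lia.
rewrite big_nat_recr /=; last lia.
rewrite big_nat big1 => [|i i_in]; last first.
  by apply: T_far; rewrite /res; [lia|case: ifP; rewrite /grow; lia].
rewrite add0r; apply: T_const_const => //; rewrite ?resE; try lia.
by rewrite /const /grow; lia.
Qed.

Lemma step_two : r = (2 * h)%N -> good q m r.
Proof.
move=> rE; have rc : const r by rewrite rE /const /grow; lia.
case/and3P: (rc) => r0 rl rg; rewrite /good /shape.
rewrite (negPf r0) (negPf rl) (negPf rg) /= -/n q_n.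
have -> : (m == 0)%N = false by lia.
have resE : res 1 = (2 * h - 1)%N by rewrite /res; case: ifP; lia.
rewrite big_ltn //; last lia.
rewrite [X in _ + X]big_nat big1 => [|i i_in]; last first.
  by apply: T_far; rewrite /res; [lia|case: ifP; rewrite /grow; lia].
rewrite addr0; apply: T_const_const => //; rewrite ?resE; try lia.
by rewrite /const /grow; lia.
Qed.

Lemma step_linear : r = (2 * h + 1)%N -> good q m r.
Proof.
move=> rE; have rg : grow r = false by rewrite rE /grow; lia.
have r0 : (r == 0)%N = false by lia.
have rl : (r == 2 * h + 1)%N by rewrite rE.
rewrite /good /shape rg r0 rl /= -/n q_n.
have -> : (m == 0)%N = false by lia.
have res1 : res 1 = (2 * h)%N by rewrite /res; case: ifP; lia.
have res2 : res 2 = (2 * h - 1)%N by rewrite /res; case: ifP; lia.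
rewrite big_ltn; last lia.
rewrite big_ltn; last lia.
rewrite [X in _ + (_ + X)]big_nat big1 => [|i i_in]; last first.
  by apply: T_far; rewrite /res; [lia|case: ifP; rewrite /grow; lia].
rewrite T_two //; last lia.
have : good q m (r - 2) by apply: IH; lia.
have -> : (r - 2)%N = (2 * h - 1)%N by lia.
have -> : good q m (2 * h - 1) = (q (s * m + (2 * h - 1))%N = s :> int).
  rewrite /good /shape /cval eqxx.
  have -> : grow (2 * h - 1) = false by rewrite /grow; lia.
  by do 3 (case: eqP => [|_]; first lia).
move=> ->.
rewrite (@T_own 2 1) //; last first.
  rewrite W_const; [|lia|rewrite res2 /const /grow; lia].
  by rewrite res2 /cval eqxx muln1.
have := @good_own 1 k_gt0; rewrite /good /shape rg r0 rl /=.
have -> : (m - 1 == 0)%N = false by lia.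
move=> ->; rewrite mulnBr muln1 addr0 -PoszD subnKC //.
by rewrite leq_pmulr; lia.
Qed.

Lemma step_delay : (2 * h + 2 <= r)%N -> const r -> good q m r.
Proof.
move=> r_ge rc; case/and3P: (rc) => r0 rl rg; rewrite /good /shape.
rewrite (negPf r0) (negPf rl) (negPf rg) /= -/n q_n.
have -> : (m == 0)%N = false by lia.
have resE i : (1 <= i <= 2 * h)%N -> res i = (r - i)%N.
  by rewrite /res; case: ifP; lia.
(* The first summand is the one subtracted in [shift]; the second is the linear class, seen exactly
   once, at offset r - (2h + 1). *)
have -> : \sum_(1 <= i < (2 * h).+1) T i = \sum_(1 <= i < (2 * h).+1)
  ((if const (r - i) then
       if (r - i == 2 * h)%N then (cval (r - 2))%:Z else (cval r)%:Z
     else 0) + (if i == (r - (2 * h + 1))%N then q r else 0)).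
  apply: eq_big_nat => i i_in; have {}resE := resE i i_in.
  case: (eqVneq i (r - (2 * h + 1))%N) => [iE|iN].
    have resl : res i = (2 * h + 1)%N by rewrite resE; lia.
    by rewrite -resE resl /const eqxx andbF /= add0r T_lin.
  rewrite addr0; case: ifP => [res_c|res_c]; last first.
    by apply: T_far => //; rewrite resE; move: res_c; rewrite /const; lia.
  case: eqP => [two_i|ntwo]; last by apply: T_const_const; rewrite ?resE //; lia.
  rewrite T_two ?resE //.
  have c2 : const (r - 2) by apply: const_sub2 => //; lia.
  have : good q m (r - 2) by apply: IH; lia.
  case/and3P: (c2) => r20 r2l r2g; rewrite /good /shape.
  rewrite (negPf r20) (negPf r2l) (negPf r2g) /=.
  by have -> : (m == 0)%N = false by lia.
rewrite big_split /= -[X in _ + X]big_mkcond big_nat1_eq ifT; last lia.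
have := good_start; rewrite /good muln0 add0n /shape (negPf r0) (negPf rg) /=.
by rewrite r_ge /= => ->; rewrite /shift addrC subrK.
Qed.

Lemma step_grow : grow r -> good q m r.
Proof.
move=> rg; rewrite /good rg -/n q_n.
have -> : (0 < m)%N by lia.
have [i [j [i_in j_in neq_ij [ic jc] [i2 j2]]]] : exists i j,
    [/\ (1 <= i <= 2 * h)%N, (1 <= j <= 2 * h)%N, i != j,
      const (res i) /\ const (res j)
      & (res i != 2 * h)%N /\ (res j != 2 * h)%N].
  (* For r <= 2h - 2 the window wraps round to classes 4h + 1 and 4h; otherwise r is odd, r - 1 is a
     constant class above 2h, and class 2h - 1 is still in reach. *)
  case: (ltnP r (2 * h)) => r_lt.
    exists r.+1, r.+2.
    have -> : res r.+1 = (4 * h + 1)%N by rewrite /res; case: ifP; lia.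
    have -> : res r.+2 = (4 * h)%N by rewrite /res; case: ifP; lia.
    by move: rg; rewrite /const /grow; split; [| | |split|split]; lia.
  exists 1%N, (r - (2 * h - 1))%N.
  have -> : res 1 = (r - 1)%N by rewrite /res; case: ifP; lia.
  have -> : res (r - (2 * h - 1)) = (2 * h - 1)%N.
    by rewrite /res; case: ifP; lia.
  by move: rg; rewrite /const /grow; split; [| | |split|split]; lia.
have le_sum : T i + T j <= \sum_(1 <= l < (2 * h).+1) T l.
  by apply: ler_sum_two => // l l_in; apply: T_ge0.
have := T_recurs_gt i_in rg ic i2; have := T_recurs_gt j_in rg jc j2.
move: (T i) (T j) le_sum => x y; move: (\sum_(_ <= _ < _) _) => S.
by have := le_sk_sm; rewrite /= /n; lia.
Qed.

Lemma step : good q m r.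
Proof.
case: (posnP r) => [/step_main//|r_gt0].
case rg: (grow r); first exact: step_grow.
case: (eqVneq r (2 * h + 1)%N) => [/step_linear//|rl].
have rc : const r by rewrite /const rg rl; lia.
case: (leqP (2 * h + 2) r) => [r_ge|r_lt]; first exact: step_delay.
case: (eqVneq r (2 * h)%N) => [/step_two//|r2].
by apply: step_unit; move: rg; rewrite /grow; lia.
Qed.

End Step.

(** * Assembling the sequence *)

Lemma meta_Fibonacci_extension :
  exists q : nat -> int,
    meta_Fibonacci q /\ forall m, q (s * m)%N = (a m)%:Z.
Proof.
(* From this block on, the preceding block is at least M, as [a_large] requires, and 2 s k <= s m,
   as the growth of large classes requires. *)
pose N := (s * (M + 2 * k + 2))%N.
pose init n := let m := (n %/ s)%N in let r := (n %% s)%N in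
  if grow r && (0 < m)%N then (n + 2 * h)%:Z + 1 else shape m r.
have [q [q_init q_rec]] := nested_rec_existence (2 * h) N init.
have s_gt0 : (0 < s)%N by lia.
have div_pos m r : (r < s)%N -> ((s * m + r) %/ s)%N = m.
  by move=> lt_r; rewrite mulnC divnMDl // divn_small // addn0.
have mod_pos m r : (r < s)%N -> ((s * m + r) %% s)%N = r.
  by move=> lt_r; rewrite mulnC modnMDl modn_small.
have back m r : (M + 2 * k + 2 <= m)%N -> (r < s)%N ->
    (forall m' r', (r' < s)%N -> (s * m' + r' < s * m + r)%N -> good q m' r') ->
    forall i, (1 <= i <= 2 * h)%N ->
    (s * m + r)%N%:Z - ext0 q ((s * m + r)%N%:Z - i%:Z) < (s * m + r)%N%:Z.
  move=> le_m lt_r IH i i_in.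
  by rewrite ltrBlDr ltrDl; apply: W_gt0.
(* Strong induction on the position: [good] at all earlier positions yields [back], which in turn
   gives access to the recurrence here. *)
have all_good m r : (r < s)%N -> good q m r.
  have [n le_n] := ubnP (s * m + r); elim: n m r le_n => // n IHn m r le_n lt_r.
  have IH m' r' : (r' < s)%N -> (s * m' + r' < s * m + r)%N -> good q m' r'.
    by move=> lt_r' lt_pos; apply: IHn => //; apply: leq_trans lt_pos _.
  case: (leqP (M + 2 * k + 2) m) => [le_m|lt_m].
    apply: step => //; apply: q_rec; last exact: back.
    by rewrite /N (leq_trans (leq_mul (leqnn s) le_m)) ?leq_addr.
  rewrite /good q_init; last first.
    by apply: leq_trans (_ : s * m.+1 <= _)%N; rewrite ?leq_mul // mulnS; lia.
  by rewrite /init div_pos // mod_pos //; case: (grow r && _); rewrite ?ltzD1.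
exists q; split; last first.
  move=> m; have := all_good m 0%N s_gt0.
  by rewrite /good /shape /= addn0 /grow /= andbF.
exists (2 * h)%N, (fun=> 1%N), N; split=> // [|n le_n]; first lia.
have nE : n = (s * (n %/ s) + n %% s)%N by rewrite mulnC -divn_eq.
have le_m : (M + 2 * k + 2 <= n %/ s)%N by rewrite leq_divRL // mulnC.
have pos := back _ _ le_m (ltn_pmod n s_gt0)
  (fun m' r' lt_r' _ => all_good m' r' lt_r').
rewrite -nE in pos; split=> //.
by rewrite q_rec //; apply: eq_bigr => i _; rewrite mul1r.
Qed.

End Construction.

Theorem theorem1 (a : nat -> nat) (k : nat) (b : nat -> nat)
    (a_gt0 : forall n : nat, (0 < a n)%N)
    (k_gt0 : (0 < k)%N)
    (b_ge2 : (2 <= \sum_(1 <= i < k.+1) b i)%N)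
    (a_rec : forall n : nat, (k <= n)%N ->
       a n = (\sum_(1 <= i < k.+1) b i * a (n - i))%N) :
  exists (q : nat -> int) (s : nat),
    [/\ meta_Fibonacci q,
        (0 < s)%N
      & forall n : nat, q (s * n)%N = Posz (a n)].
Proof.
have [w [size_w /all_nthP w_in w_sum]] := expand_multiplicities b k.
pose h := (size w).-1; pose s := (4 * h + 2)%N.
have [M a_large] := linear_rec_dominates a_gt0 k_gt0 b_ge2 a_rec s (2 * h).
have h_gt0 : (0 < h)%N by rewrite /h size_w; lia.
have hE : h.+1 = size w by rewrite /h size_w; lia.
have [q [q_meta q_a]] : exists q : nat -> int,
    meta_Fibonacci q /\ forall m, q (s * m)%N = (a m)%:Z.
  apply: (@meta_Fibonacci_extension a k h s M (nth 0%N w)) => //.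
    by move=> t le_th; apply: w_in; rewrite -hE ltnS.
  move=> m le_km; rewrite a_rec // -(w_sum (fun j => a (m - j)%N)).
  by rewrite (big_nth 0%N) hE.
by exists q, s; split=> //; rewrite /s; lia.
Qed.
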